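(* Let $\varphi \in H^2$ and let $\mathbf{H}_\varphi$ be the Hankel operator with symbol $\varphi$. If $\mathbf{H}_\varphi$ is norm-attaining and has maximal norm, then $\mathbf{H}_\varphi$ has minimal norm.
   Context: $\mathbb{T}$ is the unit circle with normalized Lebesgue arc length measure; $L^p=L^p(\mathbb{T})$. For $1\le p\le\infty$, $H^p$ is the subspace of $L^p$ of functions whose Fourier coefficients vanish at negative indices. $\overline{H^2}$ is the space of complex conjugates of functions in $H^2$, and $\overline{P}$ is the orthogonal projection of $L^2$ onto $\overline{H^2}$. For $\varphi\in H^2$, the Hankel operator $\mathbf{H}_\varphi f := \overline{P}(\overline{\varphi} f)$ is a densely defined operator from $H^2$ to $\overline{H^2}$; one always has $\|\varphi\|_2\le \|\mathbf{H}_\varphi\|\le\|\varphi\|_\infty$. $\mathbf{H}_\varphi$ has minimal norm if $\|\mathbf{H}_\varphi\|=\|\varphi\|_2$, and maximal norm if $\|\mathbf{H}_\varphi\|=\|\varphi\|_\infty$. $\mathbf{H}_\varphi$ is norm-attaining if there is $g$ in the unit sphere of $H^2$ with $\|\mathbf{H}_\varphi\| = \|\mathbf{H}_\varphi g\|_2$. *)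

(* Defs.v *)
From HB Require Import structures.
From mathcomp Require Import all_boot all_order all_algebra.
From mathcomp Require Import all_classical all_reals all_analysis.
From mathcomp Require Import complex.

Set Implicit Arguments.
Unset Strict Implicit.
Unset Printing Implicit Defensive.

Import Order.TTheory GRing.Theory Num.Theory.
Import numFieldNormedType.Exports.

Local Open Scope classical_set_scope.
Local Open Scope ring_scope.

(* The unit circle T is parametrised by t in [0,1] via t |-> exp(2 pi i t);
   normalized arc length measure = Lebesgue measure restricted to [0,1].
   A (complex-valued) function on T is a function measurableTypeR R -> R[i]; only its
   values on [0,1] matter (a.e.). *)

Definition circ_mu (R : realType) : {measure set (measurableTypeR R) -> \bar R} :=
  mrestr (@lebesgue_measure R) (measurable_itv `[0%R, 1%R]).

Definition cabs (R : realType) (z : R[i]) : R :=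
  Num.sqrt (complex.Re z ^+ 2 + complex.Im z ^+ 2).

Definition Lpnorm (R : realType) (p : \bar R) (f : measurableTypeR R -> R[i]) : \bar R :=
  Lnorm (circ_mu R) p (fun t => (cabs (f t))%:E).

Definition cmeasurable (R : realType) (f : measurableTypeR R -> R[i]) : Prop :=
  measurable_fun [set: measurableTypeR R] (fun t => complex.Re (f t)) /\
  measurable_fun [set: measurableTypeR R] (fun t => complex.Im (f t)).

Definition inL2 (R : realType) (f : measurableTypeR R -> R[i]) : Prop :=
  cmeasurable f /\ (Lpnorm 2%:E f < +oo)%E.

Definition expi (R : realType) (theta : R) : R[i] := Complex (cos theta) (sin theta).

Definition cintegral (R : realType) (f : measurableTypeR R -> R[i]) : R[i] :=
  Complex (Rintegral (circ_mu R) [set: measurableTypeR R] (fun t => complex.Re (f t)))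
          (Rintegral (circ_mu R) [set: measurableTypeR R] (fun t => complex.Im (f t))).

Definition fourier (R : realType) (f : measurableTypeR R -> R[i]) (n : int) : R[i] :=
  cintegral (fun t => f t * expi (- (2 * pi * n%:~R * t))).

Definition inH2 (R : realType) (f : measurableTypeR R -> R[i]) : Prop :=
  inL2 f /\ (forall n : int, n < 0 -> fourier f n = 0).

Definition inH2bar (R : realType) (f : measurableTypeR R -> R[i]) : Prop :=
  inH2 (fun t => conjc (f t)).

Definition ip (R : realType) (f g : measurableTypeR R -> R[i]) : R[i] :=
  cintegral (fun t => f t * conjc (g t)).

(* g is the orthogonal projection \bar P h of h in L^2 onto \overline{H^2}:
   g in \overline{H^2} and h - g is orthogonal to \overline{H^2}. *)
Definition is_Pbar (R : realType) (h g : measurableTypeR R -> R[i]) : Prop :=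
  inH2bar g /\ (forall k, inH2bar k -> ip (fun t => h t - g t) k = 0).

(* domain of the densely defined Hankel operator H_phi : H^2 -> \overline{H^2}:
   those f in H^2 with \bar phi f in L^2 *)
Definition hankel_dom (R : realType) (phi f : measurableTypeR R -> R[i]) : Prop :=
  inH2 f /\ inL2 (fun t => conjc (phi t) * f t).

Definition hankel_app (R : realType) (phi f g : measurableTypeR R -> R[i]) : Prop :=
  hankel_dom phi f /\ is_Pbar (fun t => conjc (phi t) * f t) g.

Definition hankel_norm (R : realType) (phi : measurableTypeR R -> R[i]) : \bar R :=
  ereal_sup [set Lpnorm 2%:E g | g in
     [set g | exists f, hankel_app phi f g /\ (Lpnorm 2%:E f <= 1)%E]].

Definition hankel_min_norm (R : realType) (phi : measurableTypeR R -> R[i]) : Prop :=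
  hankel_norm phi = Lpnorm 2%:E phi.

Definition hankel_max_norm (R : realType) (phi : measurableTypeR R -> R[i]) : Prop :=
  hankel_norm phi = Lpnorm +oo%E phi.

Definition hankel_norm_attaining (R : realType) (phi : measurableTypeR R -> R[i]) : Prop :=
  exists f g, hankel_app phi f g /\ Lpnorm 2%:E f = 1%E /\
              hankel_norm phi = Lpnorm 2%:E g.

(* Main.v *)
Require Import Defs.
From HB Require Import structures.
From mathcomp Require Import all_boot all_order all_algebra.
From mathcomp Require Import all_classical all_reals all_analysis.
From mathcomp Require Import complex.
From mathcomp Require Import ess_sup_inf measurable_realfun ring lra.

(* Let h = conj(phi) f with f a unit vector where the norm is attained.  The
   chain ||phi||_oo = ||Pbar h|| <= ||h|| <= ||phi||_oo ||f|| consists of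
   equalities, hence |phi| = ||phi||_oo almost everywhere on {f != 0}.  A nonzero
   function of H^2 is nonzero almost everywhere (F. and M. Riesz), so |phi| is
   constant and ||phi||_2 = ||phi||_oo.

   The uniqueness theorem comes from a Jensen-type inequality.  If u = Re P with
   P an analytic polynomial, then exp (l (P - P(0))) f has the same mean as f, so
   |mean f| <= exp (- l mean u) * mean (exp (l u) |f|).  If f vanishes on E, let
   u approach the indicator of E: the right-hand side becomes
   exp (- l m(E)) * mean |f|, which tends to 0 as l grows.  Applied to f divided
   by powers of z, this kills every Fourier coefficient of f. *)

Set Implicit Arguments.
Unset Strict Implicit.
Unset Printing Implicit Defensive.

Import Order.TTheory GRing.Theory Num.Theory.
Import numFieldNormedType.Exports.

Local Open Scope classical_set_scope.
Local Open Scope ring_scope.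

(** * Modulus, conjugation and unimodular exponentials *)

Section complex_modulus.
Variable R : realType.
Implicit Types x y z : R[i].

Lemma cabsE z : cabs z = Normc.normc z.
Proof. by case: z. Qed.

Lemma cabs_ge0 z : 0 <= cabs z.
Proof. exact: sqrtr_ge0. Qed.

Lemma sqr_cabs z : cabs z ^+ 2 = complex.Re z ^+ 2 + complex.Im z ^+ 2.
Proof. by rewrite sqr_sqrtr// addr_ge0// sqr_ge0. Qed.

Lemma cabsM x y : cabs (x * y) = cabs x * cabs y.
Proof. by rewrite !cabsE Normc.normcM. Qed.

Lemma cabsX x n : cabs (x ^+ n) = cabs x ^+ n.
Proof.
elim: n => [|n IH]; last by rewrite !exprS cabsM IH.
by rewrite !expr0 cabsE Normc.normc1.
Qed.

Lemma cabs_conjc z : cabs (conjc z) = cabs z.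
Proof. by case: z => a b; rewrite /cabs /= sqrrN. Qed.

Lemma cabs0 : cabs (0 : R[i]) = 0.
Proof. by rewrite cabsE Normc.normc0. Qed.

Lemma cabs_eq0 z : (cabs z == 0) = (z == 0).
Proof.
apply/eqP/eqP => [|->]; last exact: cabs0.
by rewrite cabsE => /Normc.eq0_normc.
Qed.

Lemma le_cabsD x y : cabs (x + y) <= cabs x + cabs y.
Proof. by rewrite !cabsE le_normcD. Qed.

Lemma norm_Re_le_cabs z : `|complex.Re z| <= cabs z.
Proof. by rewrite -sqrtr_sqr ler_wsqrtr// lerDl sqr_ge0. Qed.

Lemma norm_Im_le_cabs z : `|complex.Im z| <= cabs z.
Proof. by rewrite -sqrtr_sqr ler_wsqrtr// lerDr sqr_ge0. Qed.

Lemma cabs_le_ReIm z : cabs z <= `|complex.Re z| + `|complex.Im z|.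
Proof.
rewrite -(@ler_pXn2r _ 2) ?nnegrE ?cabs_ge0// ?addr_ge0//.
rewrite sqr_cabs sqrrD !real_normK ?num_real//.
by rewrite addrAC lerDl mulrn_wge0// mulr_ge0.
Qed.

Lemma ReD x y : complex.Re (x + y) = complex.Re x + complex.Re y.
Proof. by case: x y => a b []. Qed.

Lemma ImD x y : complex.Im (x + y) = complex.Im x + complex.Im y.
Proof. by case: x y => a b []. Qed.

Lemma ReM x y : complex.Re (x * y) =
  complex.Re x * complex.Re y - complex.Im x * complex.Im y.
Proof. by case: x y => a b []. Qed.

Lemma ImM x y : complex.Im (x * y) =
  complex.Re x * complex.Im y + complex.Im x * complex.Re y.
Proof. by case: x y => a b []. Qed.

Lemma conjcM x y : conjc (x * y) = conjc x * conjc y.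
Proof. exact: (rmorphM (@conjc R)). Qed.

Lemma conjcX x n : conjc (x ^+ n) = conjc x ^+ n.
Proof. exact: (rmorphXn (@conjc R)). Qed.

Lemma eq_ReIm x y : complex.Re x = complex.Re y ->
  complex.Im x = complex.Im y -> x = y.
Proof. by case: x y => a b [c d]/= -> ->. Qed.

Lemma expi0 : expi (0 : R) = 1.
Proof. by rewrite /expi cos0 sin0. Qed.

Lemma expiD (a b : R) : expi (a + b) = expi a * expi b.
Proof.
by apply: eq_ReIm; rewrite ?ReM ?ImM/= ?cosD ?sinD//; ring.
Qed.

Lemma cabs_expi (a : R) : cabs (expi a) = 1.
Proof. by rewrite /cabs/= cos2Dsin2 sqrtr1. Qed.

Lemma expiX (a : R) k : expi a ^+ k = expi (k%:R * a).
Proof.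
elim: k => [|k IH]; first by rewrite mul0r expi0 expr0.
by rewrite exprS IH -expiD; congr expi; rewrite -natr1 mulrDl mul1r addrC.
Qed.

End complex_modulus.

(** * The coordinate of the circle and the algebra of real trigonometric polynomials *)

Section circle_coordinate.
Variable R : realType.
Implicit Types (t : R) (P Q : {poly R[i]}).

Definition zeta t : R[i] := expi (2 * pi * t).

Lemma cabs_zeta t : cabs (zeta t) = 1.
Proof. exact: cabs_expi. Qed.

Lemma zetaX t k : zeta t ^+ k = expi (2 * pi * k%:R * t).
Proof. by rewrite expiX; congr expi; ring. Qed.

Lemma zeta_conjK t : zeta t * conjc (zeta t) = 1.
Proof.
apply: eq_ReIm; rewrite ?ReM ?ImM/=; last by ring.
by rewrite mulrN opprK -!expr2 cos2Dsin2.
Qed.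

Lemma poly_zeta_bounded P : exists2 M : R, 0 <= M &
  forall t, cabs P.[zeta t] <= M.
Proof.
elim/poly_ind: P => [|P c [M M0 PM]].
  by exists 0 => // t; rewrite horner0 cabs0.
exists (M + cabs c); first by rewrite addr_ge0// cabs_ge0.
move=> t; rewrite hornerMXaddC (le_trans (le_cabsD _ _))// lerD2r.
by rewrite cabsM cabs_zeta mulr1.
Qed.

(* Real trigonometric polynomials, represented as real parts of analytic
   ones. *)
Definition rtrig (u : R -> R) : Prop :=
  exists P : {poly R[i]}, forall t, u t = complex.Re P.[zeta t].

Lemma rtrig_ext u v : u =1 v -> rtrig u -> rtrig v.
Proof. by move=> uv [P uP]; exists P => t; rewrite -uv. Qed.

Lemma rtrigD u v : rtrig u -> rtrig v -> rtrig (fun t => u t + v t).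
Proof.
by move=> [P uP] [Q vQ]; exists (P + Q) => t; rewrite hornerD ReD uP vQ.
Qed.

Lemma rtrig_cst c : rtrig (fun=> c).
Proof. by exists (c%:C%C)%:P => t; rewrite hornerC. Qed.

Lemma rtrig_monomial (a : R[i]) k :
  rtrig (fun t => complex.Re (a * zeta t ^+ k)).
Proof. by exists (a *: 'X^k) => t; rewrite hornerZ hornerXn. Qed.

(** On the circle [zeta t] and its conjugate are inverse to each other, so only a single power
    survives. If j < k it is a power of the conjugate, and conjugating the whole term, which keeps
    its real part, makes it analytic. *)
Lemma rtrig_conj_monomial (a : R[i]) j k :
  rtrig (fun t => complex.Re (a * zeta t ^+ j * conjc (zeta t) ^+ k)).
Proof.
have [kj|/ltnW jk] := leqP k j.
  apply: rtrig_ext (rtrig_monomial a (j - k)) => t.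
  rewrite -[X in _ = complex.Re (_ * zeta t ^+ X * _)](subnK kj) exprD.
  by rewrite -!mulrA -exprMn zeta_conjK expr1n mulr1.
apply: rtrig_ext (rtrig_monomial (conjc a) (k - j)) => t.
rewrite -[X in _ = complex.Re (_ * conjc _ ^+ X)](subnK jk) exprD.
rewrite (mulrC (conjc _ ^+ _)) mulrA -(mulrA a) -exprMn zeta_conjK expr1n mulr1.
have -> : conjc a * zeta t ^+ (k - j) = conjc (a * conjc (zeta t) ^+ (k - j)).
  by rewrite conjcM conjcX conjcK.
by case: (a * _).
Qed.

Lemma rtrig_sum (I : Type) (s : seq I) (u : I -> R -> R) :
  (forall i, rtrig (u i)) -> rtrig (fun t => \sum_(i <- s) u i t).
Proof.
move=> ru; elim: s => [|i s IH].
  by apply: rtrig_ext (rtrig_cst 0) => t; rewrite big_nil.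
by apply: rtrig_ext (rtrigD (ru i) IH) => t; rewrite big_cons.
Qed.

Lemma Re_sum (I : Type) (s : seq I) (F : I -> R[i]) :
  complex.Re (\sum_(i <- s) F i) = \sum_(i <- s) complex.Re (F i).
Proof. by apply: (big_morph _ (@ReD R)). Qed.

(** The identity Re A Re B = Re (A (B + conj B)) / 2 turns a product of real parts into a real part.
    Expanding both polynomials leaves the two kinds of monomials treated above. *)
Lemma rtrigM u v : rtrig u -> rtrig v -> rtrig (fun t => u t * v t).
Proof.
move=> [P uP] [Q vQ].
pose F (i j : nat) (t : R) : R :=
  complex.Re (2^-1 * P`_i * Q`_j * zeta t ^+ (i + j)) +
  complex.Re (2^-1 * P`_i * conjc Q`_j * zeta t ^+ i * conjc (zeta t) ^+ j).
have rF i j : rtrig (F i j).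
  by apply: rtrigD; [exact: rtrig_monomial | exact: rtrig_conj_monomial].
apply: (@rtrig_ext (fun t => \sum_(i < size P) \sum_(j < size Q) F i j t)).
  move=> t; rewrite uP vQ 2!horner_coef !Re_sum big_distrlr/=.
  apply: eq_bigr => i _; apply: eq_bigr => j _.
  rewrite /F -ReD.
  set A := P`_i * zeta t ^+ i; set B := Q`_j * zeta t ^+ j.
  have -> : 2^-1 * P`_i * Q`_j * zeta t ^+ (i + j) + 2^-1 * P`_i * conjc Q`_j *
     zeta t ^+ i * conjc (zeta t) ^+ j = 2^-1 * A * (B + conjc B).
    rewrite /A /B conjcM conjcX exprD; ring.
  rewrite addcJ mulrCA mulrA mulVKf ?pnatr_eq0//.
  by case: A => a b; case: B => c d; rewrite ReM/=; ring.
by apply: rtrig_sum => i; apply: rtrig_sum => j.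
Qed.

Lemma rtrigX u n : rtrig u -> rtrig (fun t => u t ^+ n).
Proof.
move=> ru; elim: n => [|n IH].
  by apply: rtrig_ext (rtrig_cst 1) => t; rewrite expr0.
by apply: rtrig_ext (rtrigM ru IH) => t; rewrite exprS.
Qed.

Lemma rtrig_onem u : rtrig u -> rtrig (fun t => 1 - u t).
Proof.
move=> ru; apply: rtrig_ext (rtrigD (rtrig_cst 1) (rtrigM (rtrig_cst (-1)) ru)).
by move=> t; rewrite mulN1r.
Qed.

(* On (0, 1) this product has the sign of t - x. *)
Lemma rtrig_sin_sin x : rtrig (fun t => sin (pi * t) * sin (pi * (t - x))).
Proof.
(* Product to sum: the function is (cos (pi x) - cos (2 pi t - pi x)) / 2, and [a] is - exp (i pi x)
   / 2. *)
pose a : R[i] := Complex (- (cos (pi * x) / 2)) (- (sin (pi * x) / 2)).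
apply: (@rtrig_ext (fun t => cos (pi * x) / 2 +
  complex.Re (conjc a * zeta t ^+ 1))); last first.
  by apply: rtrigD; [exact: rtrig_cst | exact: rtrig_monomial].
move=> t; rewrite expr1 ReM /=.
have -> : 2 * pi * t = pi * t + pi * t by ring.
rewrite mulrBr sinB cosD sinD.
have := cos2Dsin2 (pi * t).
set c := cos (pi * t); set s := sin (pi * t); set d := cos _; set e := sin _.
(* Multiplying cos^2 + sin^2 = 1 by [d] makes the remaining identity linear in the monomials. *)
move=> cs; have : d * (c ^+ 2 + s ^+ 2) = d by rewrite cs mulr1.
lra.
Qed.

End circle_coordinate.

(** * Integrals against a restricted measure *)

Section integral_mrestr.
Context d (T : measurableType d) (R : realType).
Variables (mu : {measure set T -> \bar R}) (D : set T) (mD : measurable D).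
Local Open Scope ereal_scope.

(** The measure [mu] is the sum of its restrictions to [D] and to the complement. The function
    [f \_ D] is zero almost everywhere for the second restriction and equal to [f] almost everywhere
    for the first. *)
Lemma ge0_integral_mrestr (f : T -> \bar R) : measurable_fun setT f ->
  (forall x, 0 <= f x) ->
  \int[mrestr mu mD]_x f x = \int[mu]_(x in D) f x.
Proof.
move=> mf f0; have mDC := measurableC mD.
have mfD : measurable_fun setT (f \_ D).
  exact/(measurable_restrictT f mD)/measurable_funTS.
have fD0 x : 0 <= (f \_ D) x by rewrite /patch; case: ifP.
rewrite [RHS]integral_mkcond.
rewrite [RHS](eq_measure_integral
  (measure_add (mrestr mu mD) (mrestr mu mDC))); last first.
  move=> A mA _; rewrite (measureDI mu mA mD) addeC setDE.
  exact/esym/(measure_addE (mrestr mu mD) (mrestr mu mDC)).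
rewrite ge0_integral_measure_add//.
rewrite [X in _ = _ + X](ae_eq_integral (cst 0))//; last first.
  exists D; split => //; first by rewrite -(measure0 mu) -(setICr D).
  move=> x /= fx; apply: contrapT => Dx; apply: fx => _.
  by rewrite /patch; case: ifPn => //; rewrite inE.
rewrite integral0 adde0; apply: ae_eq_integral => //.
exists (~` D); split => //; first by rewrite -(measure0 mu) -(setICl D).
move=> x /= fx Dx; apply: fx => _.
by rewrite /patch mem_set.
Qed.

Lemma integral_mrestr (f : T -> \bar R) : measurable_fun setT f ->
  \int[mrestr mu mD]_x f x = \int[mu]_(x in D) f x.
Proof.
move=> mf; rewrite [LHS]integralE [RHS]integralE !ge0_integral_mrestr//.
- exact: measurable_funeneg.
- exact: measurable_funepos.
Qed.

End integral_mrestr.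

(** * Real integrals over the circle *)

Section circle_measure.
Variable R : realType.
Local Notation mu := (circ_mu R).
Local Notation T := (measurableTypeR R).
Implicit Types (f g : T -> R[i]) (u v : T -> R).

Lemma circ_mu_setT : mu [set: T] = 1%E.
Proof.
rewrite /circ_mu /= /mrestr setTI lebesgue_measure_itv/= lte_fin ltr01.
by rewrite -EFinD subr0.
Qed.

Definition intg u := mu.-integrable [set: T] (EFin \o u).

Lemma intgD u v : intg u -> intg v -> intg (fun t => u t + v t).
Proof. exact: integrableD. Qed.

Lemma intgB u v : intg u -> intg v -> intg (fun t => u t - v t).
Proof. exact: integrableB. Qed.

Lemma intgZ c u : intg u -> intg (fun t => c * u t).
Proof. exact: integrableZl. Qed.

Lemma intg_norm u : intg u -> intg (fun t => `|u t|).
Proof. exact: integrable_norm. Qed.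

Lemma intg_measurable u : intg u -> measurable_fun [set: T] u.
Proof. by move=> /measurable_int/measurable_EFinP. Qed.

Lemma intg_le u v : measurable_fun [set: T] u ->
  (forall t, `|u t| <= v t) -> intg v -> intg u.
Proof.
move=> mu_ uv; apply: le_integrable => //; first exact/measurable_EFinP.
by move=> t _; rewrite /= lee_fin (le_trans (uv t))// ler_norm.
Qed.

Lemma intg_bounded u (M : R) : measurable_fun [set: T] u ->
  (forall t, `|u t| <= M) -> intg u.
Proof.
move=> mu_ uM; apply: measurable_bounded_integrable => //.
  by rewrite circ_mu_setT ltry.
exists M; split; first exact: num_real.
by move=> r Mr t _; rewrite /= (le_trans (uM t))// ltW.
Qed.

Lemma intg_cst c : intg (fun=> c).
Proof. by apply: (@intg_bounded _ `|c|). Qed.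

Lemma intgM_bounded u v (M : R) : measurable_fun [set: T] u ->
  (forall t, `|u t| <= M) -> intg v -> intg (fun t => u t * v t).
Proof.
move=> mu_ uM iv; apply: (@intg_le _ (fun t => M * `|v t|)).
- by apply: measurable_funM => //; exact: intg_measurable.
- by move=> t; rewrite normrM ler_wpM2r.
- by apply: intgZ; exact: intg_norm.
Qed.

Local Notation Int u := (\int[mu]_x u x).

Lemma Int_cst c : Int (fun=> c) = c.
Proof. by rewrite Rintegral_cst// circ_mu_setT mulr1. Qed.

Lemma IntD u v : intg u -> intg v -> Int (fun t => u t + v t) = Int u + Int v.
Proof. exact: RintegralD. Qed.

Lemma IntB u v : intg u -> intg v -> Int (fun t => u t - v t) = Int u - Int v.
Proof. exact: RintegralB. Qed.

Lemma IntZ c u : intg u -> Int (fun t => c * u t) = c * Int u.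
Proof. exact: RintegralZl. Qed.

Lemma le_Int u v : intg u -> intg v -> (forall t, u t <= v t) -> Int u <= Int v.
Proof. by move=> iu iv uv; exact: le_Rintegral. Qed.

Lemma Int_ge0 u : (forall t, 0 <= u t) -> 0 <= Int u.
Proof. by move=> u0; exact: Rintegral_ge0. Qed.

Lemma norm_Int_le u v : intg u -> intg v -> (forall t, `|u t| <= v t) ->
  `|Int u| <= Int v.
Proof.
move=> iu iv uv; apply: (le_trans (le_normr_Rintegral _ iu)) => //.
by apply: le_Int => //; exact: intg_norm.
Qed.

Lemma Int_EFin u : intg u -> (\int[mu]_x (u x)%:E)%E = (Int u)%:E.
Proof. by move=> iu; rewrite /Rintegral fineK// integrable_fin_num. Qed.

Lemma eq_Int u v : u =1 v -> Int u = Int v.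
Proof. by move=> uv; apply: eq_Rintegral => x _; exact: uv. Qed.

Lemma Int_eq0_ae u : intg u -> (forall t, 0 <= u t) -> Int u = 0 ->
  {ae mu, forall t, u t = 0}.
Proof.
move=> iu u0 Iu.
have /ae_eq_integral_abs : measurable_fun [set: T] (EFin \o u).
  exact: measurable_int iu.
move=> /(_ mu measurableT) [+ _].
case.
  under eq_integral do rewrite /= ger0_norm//.
  by rewrite Int_EFin// Iu.
move=> N [mN N0 sN]; exists N; split => // t /= ut.
by apply: sN => /= h; apply: ut; case: (h Logic.I).
Qed.

End circle_measure.

(** * Complex integrals and moments over the circle *)

Section complex_integral.
Variable R : realType.
Local Notation mu := (circ_mu R).
Local Notation T := (measurableTypeR R).
Local Notation Int u := (\int[mu]_x u x).
Implicit Types (f g h : T -> R[i]) (u v : T -> R).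

Lemma cmeasurable_cst (c : R[i]) : cmeasurable (fun=> c : R[i]).
Proof. by split; exact: measurable_cst. Qed.

Lemma cmeasurableD f g : cmeasurable f -> cmeasurable g ->
  cmeasurable (fun t => f t + g t).
Proof.
move=> [f1 f2] [g1 g2]; split.
  under eq_fun do rewrite ReD.
  exact: measurable_funD.
under eq_fun do rewrite ImD.
exact: measurable_funD.
Qed.

Lemma cmeasurableM f g : cmeasurable f -> cmeasurable g ->
  cmeasurable (fun t => f t * g t).
Proof.
move=> [f1 f2] [g1 g2]; split.
  under eq_fun do rewrite ReM.
  by apply: measurable_funB; exact: measurable_funM.
under eq_fun do rewrite ImM.
by apply: measurable_funD; exact: measurable_funM.
Qed.

Lemma cmeasurableX f k : cmeasurable f -> cmeasurable (fun t => f t ^+ k).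
Proof.
move=> mf; elim: k => [|k IH].
  under eq_fun do rewrite expr0.
  exact: cmeasurable_cst.
under eq_fun do rewrite exprS.
exact: cmeasurableM.
Qed.

Lemma cmeasurable_conjc f : cmeasurable f -> cmeasurable (fun t => conjc (f t)).
Proof.
have ReJ z : complex.Re (conjc z) = complex.Re z :> R by case: z.
have ImJ z : complex.Im (conjc z) = - complex.Im z :> R by case: z.
move=> [f1 f2]; split; first by under eq_fun do rewrite ReJ.
under eq_fun do rewrite ImJ.
exact: measurable_funN.
Qed.

Lemma cmeasurable_cabs f : cmeasurable f ->
  measurable_fun [set: T] (fun t => cabs (f t)).
Proof.
move=> [f1 f2]; rewrite /cabs.
apply: (@measurableT_comp _ _ _ _ _ _ (@Num.sqrt R)).
  by apply: continuous_measurable_fun; exact: sqrt_continuous.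
by apply: measurable_funD; exact: measurable_funX.
Qed.

Lemma cmeasurable_zeta : cmeasurable (@zeta R : T -> R[i]).
Proof.
split; rewrite /zeta/=.
  apply: (@measurableT_comp _ _ _ _ _ _ (@cos R)).
    by apply: continuous_measurable_fun; exact: continuous_cos.
  exact: mulrl_measurable.
apply: (@measurableT_comp _ _ _ _ _ _ (@sin R)).
  by apply: continuous_measurable_fun; exact: continuous_sin.
exact: mulrl_measurable.
Qed.

Lemma cmeasurable_poly (P : {poly R[i]}) :
  cmeasurable (fun t : T => P.[zeta t]).
Proof.
elim/poly_ind: P => [|P c mP].
  under eq_fun do rewrite horner0.
  exact: cmeasurable_cst.
under eq_fun do rewrite hornerMXaddC.
apply: cmeasurableD; last exact: cmeasurable_cst.
by apply: cmeasurableM => //; exact: cmeasurable_zeta.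
Qed.

Lemma rtrig_measurable u : rtrig u -> measurable_fun [set: T] u.
Proof.
by move=> [P uP]; rewrite (funext uP); case: (cmeasurable_poly P).
Qed.

Definition cintg f := intg (fun t => complex.Re (f t)) /\
  intg (fun t => complex.Im (f t)).

Lemma cintg_measurable f : cintg f -> cmeasurable f.
Proof. by move=> [f1 f2]; split; exact: intg_measurable. Qed.

Lemma cintg_cabs f : cintg f -> intg (fun t => cabs (f t)).
Proof.
move=> cf; have [f1 f2] := cf.
apply: (@intg_le _ _ (fun t => `|complex.Re (f t)| + `|complex.Im (f t)|)).
- by apply: cmeasurable_cabs; exact: cintg_measurable.
- by move=> t; rewrite ger0_norm ?cabs_ge0// cabs_le_ReIm.
- by apply: intgD; exact: intg_norm.
Qed.

Lemma cintg_le f u : cmeasurable f -> (forall t, cabs (f t) <= u t) ->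
  intg u -> cintg f.
Proof.
move=> [f1 f2] fu iu; split; apply: intg_le iu => // t.
  exact: le_trans (norm_Re_le_cabs _) (fu t).
exact: le_trans (norm_Im_le_cabs _) (fu t).
Qed.

Lemma cintg_cst (c : R[i]) : cintg (fun=> c).
Proof. by split; exact: intg_cst. Qed.

Lemma cintgM_bounded g f (M : R) : cmeasurable g ->
  (forall t, cabs (g t) <= M) -> cintg f -> cintg (fun t => g t * f t).
Proof.
move=> mg gM cf; apply: (@cintg_le _ (fun t => M * cabs (f t))).
- by apply: cmeasurableM => //; exact: cintg_measurable.
- by move=> t; rewrite cabsM ler_wpM2r// cabs_ge0.
- exact/intgZ/cintg_cabs.
Qed.

Lemma cintgM_poly (P : {poly R[i]}) f : cintg f ->
  cintg (fun t => P.[zeta t] * f t).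
Proof.
move=> cf; have [M _ PM] := poly_zeta_bounded P.
exact: (cintgM_bounded (cmeasurable_poly P) PM).
Qed.

Lemma cintgM_unimodularX g f k : cmeasurable g -> (forall t, cabs (g t) = 1) ->
  cintg f -> cintg (fun t => g t ^+ k * f t).
Proof.
move=> mg g1; apply: (@cintgM_bounded _ _ 1); first exact: cmeasurableX.
by move=> t; rewrite cabsX g1 expr1n.
Qed.

Lemma cintgM_zetaX k f : cintg f -> cintg (fun t => zeta t ^+ k * f t).
Proof.
by apply: cintgM_unimodularX; [exact: cmeasurable_zeta|exact: cabs_zeta].
Qed.

Lemma cintgM_conj_zetaX k f : cintg f ->
  cintg (fun t => conjc (zeta t) ^+ k * f t).
Proof.
apply: cintgM_unimodularX; first exact/cmeasurable_conjc/cmeasurable_zeta.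
by move=> t; rewrite cabs_conjc cabs_zeta.
Qed.

Lemma cintgZ c f : cintg f -> cintg (fun t => c * f t).
Proof.
by apply: (@cintgM_bounded _ _ (cabs c)) => //; exact: cmeasurable_cst.
Qed.

Lemma cintegralD f g : cintg f -> cintg g ->
  cintegral (fun t => f t + g t) = cintegral f + cintegral g.
Proof.
move=> [f1 f2] [g1 g2]; apply: eq_ReIm; rewrite ?ReD ?ImD/= -IntD//.
  by apply: eq_Int => t; rewrite ReD.
by apply: eq_Int => t; rewrite ImD.
Qed.

Lemma cintegralZ c f : cintg f ->
  cintegral (fun t => c * f t) = c * cintegral f.
Proof.
move=> [f1 f2]; apply: eq_ReIm; rewrite ?ReM ?ImM/= -!IntZ//.
  rewrite -IntB; [|exact: intgZ..].
  by apply: eq_Int => t; rewrite ReM.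
rewrite -IntD; [|exact: intgZ..].
by apply: eq_Int => t; rewrite ImM.
Qed.

Lemma eq_cintegral f g : f =1 g -> cintegral f = cintegral g.
Proof. by move=> fg; apply: eq_ReIm; apply: eq_Int => t; rewrite fg. Qed.

(** The moments of [f] against positive powers of [zeta] vanish, so only the constant term of [P]
    contributes. *)
Lemma cintegral_poly_mul (P : {poly R[i]}) f : cintg f ->
  (forall k, cintegral (fun t => zeta t ^+ k.+1 * f t) = 0) ->
  cintegral (fun t => P.[zeta t] * f t) = P.[0] * cintegral f.
Proof.
move=> cf f0.
(* In the induction, passing from P to P X + c raises the power of [zeta]; the extra factor
   [zeta t ^+ k] absorbs this shift. *)
suff : forall k, cintegral (fun t => zeta t ^+ k * (P.[zeta t] * f t)) =
    (k == 0%N)%:R * (P.[0] * cintegral f).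
  move=> /(_ 0%N); rewrite eqxx mul1r => <-.
  by apply: eq_cintegral => t; rewrite expr0 mul1r.
elim/poly_ind: P => [|P c IH] k.
  rewrite (eq_cintegral (g := fun t => 0 * f t)) ?cintegralZ//.
    by rewrite horner0 !mul0r mulr0.
  by move=> t; rewrite horner0 mul0r mulr0.
rewrite (eq_cintegral (g := fun t => zeta t ^+ k.+1 * (P.[zeta t] * f t) +
   c * (zeta t ^+ k * f t))); last first.
  by move=> t; rewrite hornerMXaddC exprS; ring.
rewrite cintegralD; [|exact/cintgM_zetaX/cintgM_poly|
  exact/cintgZ/cintgM_zetaX].
rewrite IH/= mul0r add0r cintegralZ; last exact: cintgM_zetaX.
rewrite hornerMXaddC mulr0 add0r.
case: k => [|k]; last by rewrite f0 mul0r mulr0.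
by rewrite mul1r; congr (_ * _); apply: eq_cintegral => t; rewrite mul1r.
Qed.

Lemma Int_circ_mu u : measurable_fun [set: T] u ->
  Int u = (\int[@lebesgue_measure R]_(x in `[0%R, 1%R]) u x).
Proof.
move=> mu_; rewrite /Rintegral; congr fine; rewrite /circ_mu.
by apply: integral_mrestr; exact/measurable_EFinP.
Qed.

Lemma Int_primitive (F u : R -> R) :
  (forall t : R, is_derive t (1 : R) F (u t)) -> continuous u -> F 0 = F 1 ->
  Int u = 0.
Proof.
move=> dF cu F01.
rewrite Int_circ_mu; last exact: continuous_measurable_fun.
rewrite /Rintegral (@continuous_FTC2 _ u F 0 1)//.
- by rewrite F01 subee.
- exact: continuous_subspaceT.
- have cF : continuous F.
    move=> x; apply: differentiable_continuous; apply/derivable1_diffP.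
    exact: ex_derive.
  split.
  + by move=> x _; exact: ex_derive.
  + by apply: cvg_at_right_filter; exact: cF.
  + by apply: cvg_at_left_filter; exact: cF.
- by move=> x _; rewrite derive1E; apply: derive_val.
Qed.

Lemma cintegral_zetaX k : cintegral (fun t => zeta t ^+ k.+1) = 0 :> R[i].
Proof.
(* The exponent [k.+1] makes [c] nonzero, so cos (c t) and sin (c t) have primitives proportional to
   sin (c t) and cos (c t), which agree at 0 and 1. *)
pose c : R := 2 * pi * k.+1%:R.
have c0 : c != 0 by rewrite !mulf_neq0// ?pnatr_eq0// gt_eqF// pi_gt0.
have cE : c = pi *+ 2 *+ k.+1.
  by rewrite /c -[RHS]mulr_natr -[pi *+ 2]mulr_natr; ring.
have cosc : cos c = 1.
  by rewrite cE -[X in cos X]add0r (periodicn (@cosD2pi R)) cos0.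
have sinc : sin c = 0.
  by rewrite cE -[X in sin X]add0r (periodicn (@sinD2pi R)) sin0.
have clin : continuous (fun t : R => c * t) by move=> t; exact: mulrl_continuous.
apply: eq_ReIm => /=.
  rewrite (eq_Int (v := fun t : R => cos (c * t)));
    last by move=> t; rewrite zetaX.
  apply: (@Int_primitive (fun t => c^-1 * sin (c * t))).
  - move=> t; apply: is_derive_eq.
    by rewrite /GRing.scale/=; field.
  - by move=> t; apply: continuous_comp; [exact: clin|exact: continuous_cos].
  - by rewrite mulr0 mulr1 sinc sin0.
rewrite (eq_Int (v := fun t : R => sin (c * t)));
    last by move=> t; rewrite zetaX.
apply: (@Int_primitive (fun t => - c^-1 * cos (c * t))).
- move=> t; apply: is_derive_eq.
  by rewrite /GRing.scale/=; field.
- by move=> t; apply: continuous_comp; [exact: clin|exact: continuous_sin].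
- by rewrite mulr0 mulr1 cosc cos0.
Qed.

(** The mean value property, obtained by taking f = 1 in [cintegral_poly_mul]. *)
Lemma Int_rtrig (P : {poly R[i]}) :
  Int (fun t => complex.Re P.[zeta t]) = complex.Re P.[0].
Proof.
have cst1 : cintegral (fun=> 1 : R[i]) = 1 :> R[i].
  by apply: eq_ReIm; exact: Int_cst.
have : cintegral (fun t => P.[zeta t] * 1) = P.[0].
  rewrite (cintegral_poly_mul P (cintg_cst 1)) ?cst1 ?mulr1// => k.
  rewrite -[RHS](cintegral_zetaX k).
  by apply: eq_cintegral => t; rewrite mulr1.
by move=> /(congr1 (@complex.Re R)) <-; apply: eq_Int => t; rewrite mulr1.
Qed.

End complex_integral.

(** * Polynomials converging to a step function *)

Section polynomial_step.
Variable R : realType.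
Implicit Types (y a : R) (n m : nat).

Lemma bernoulli_le a m : -1 <= a -> 1 + m%:R * a <= (1 + a) ^+ m.
Proof.
move=> a1; elim: m => [|m IH]; first by rewrite mul0r addr0 expr0.
rewrite exprSr; apply: (@le_trans _ _ ((1 + m%:R * a) * (1 + a))).
  rewrite -natr1; have : 0 <= m%:R * a ^+ 2 by rewrite mulr_ge0// sqr_ge0.
  by lra.
by rewrite ler_wpM2r//; lra.
Qed.

(* These polynomials in y tend to the indicator of [0, 1/2) on [0, 1] minus
   the point 1/2 (Brosowski and Deutsch). *)
Definition step n y : R := (1 - y ^+ n) ^+ (2 ^ n).

Lemma step01 n y : 0 <= y <= 1 -> 0 <= step n y <= 1.
Proof.
move=> /andP[y0 y1]; have yn0 : 0 <= y ^+ n by rewrite exprn_ge0.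
have yn1 : y ^+ n <= 1 by rewrite exprn_ile1.
by rewrite exprn_ge0 ?exprn_ile1//; lra.
Qed.

(** Bernoulli's inequality gives 1 - (2 y)^n <= [step n y] <= 1, and 2 y < 1. *)
Lemma cvg_step_lt y : 0 <= y < 2^-1 -> step n y @[n --> \oo] --> (1 : R).
Proof.
move=> /andP[y0 y2].
have yn n : 0 <= y ^+ n <= 1.
  by rewrite exprn_ge0//= exprn_ile1//; lra.
have r1 : (2 * y) ^+ n @[n --> \oo] --> (0 : R).
  by apply: cvg_expr; rewrite ger0_norm//; lra.
apply: (@squeeze_cvgr _ _ _ _ (fun n => 1 - (2 * y) ^+ n) (fun=> 1)).
- apply: nearW => n; apply/andP; split; last first.
    by have /andP[] := @step01 n y ltac:(lra).
  have := @bernoulli_le (- y ^+ n) (2 ^ n); rewrite natrX mulrN -exprMn.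
  by apply; move: (yn n); lra.
- by rewrite -[X in _ --> X]subr0; apply: cvgB => //; exact: cvg_cst.
- exact: cvg_cst.
Qed.

(** By Bernoulli, (2 y)^n <= (1 + y^n)^(2^n). Multiplied by [step n y] the right-hand side becomes
    (1 - y^(2n))^(2^n) <= 1, so [step n y] <= (2 y)^(-n), and 2 y > 1. *)
Lemma cvg_step_gt y : 2^-1 < y <= 1 -> step n y @[n --> \oo] --> (0 : R).
Proof.
move=> /andP[y0 y2]; have y_gt0 : 0 < 2 * y by lra.
have yn n : 0 <= y ^+ n <= 1.
  by rewrite exprn_ge0//= ?exprn_ile1//; lra.
have r1 : (2 * y)^-1 ^+ n @[n --> \oo] --> (0 : R).
  apply: cvg_expr; rewrite ger0_norm ?invr_ge0 ?ltW//.
  by rewrite invf_lt1//; lra.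
apply: (@squeeze_cvgr _ _ _ _ (fun=> 0) (fun n => (2 * y)^-1 ^+ n)).
- apply: nearW => n; have /andP[s0 _] := @step01 n y ltac:(lra).
  rewrite s0/= exprVn -[leRHS]mul1r ler_pdivlMr ?exprn_gt0//.
  apply: (@le_trans _ _ (step n y * (1 + y ^+ n) ^+ (2 ^ n))).
    rewrite ler_wpM2l//.
    have := @bernoulli_le (y ^+ n) (2 ^ n); rewrite natrX -exprMn => b.
    by rewrite (le_trans _ (b _))//; [lra|move: (yn n); lra].
  rewrite /step -exprMn exprn_ile1//; move: (yn n); nra.
- exact: cvg_cst.
- exact: r1.
Qed.

End polynomial_step.

(** * Approximation of indicators by trigonometric polynomials in weighted L^1 *)

Section approximation.
Variable R : realType.
Local Notation mu := (circ_mu R).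
Local Notation T := (measurableTypeR R).
Local Notation Int u := (\int[mu]_x u x).
Variable w : T -> R.
Hypotheses (iw : intg w) (w0 : forall t, 0 <= w t).
Implicit Types (u v g h : T -> R) (A : set T).

Definition unitval g := measurable_fun [set: T] g /\ forall t, 0 <= g t <= 1.

(** Keeping the approximants between 0 and 1 makes the class stable under products, and later lets
    exp (l u) be bounded by a chord. The weight [w] is meant to involve the modulus of the function
    under study. *)
Definition apx g := forall eps, 0 < eps -> exists u,
  [/\ rtrig u, forall t, 0 <= u t <= 1 &
      Int (fun t => `|u t - g t| * w t) <= eps].

Lemma unitval_rtrig u : rtrig u -> (forall t, 0 <= u t <= 1) -> unitval u.
Proof. by move=> /rtrig_measurable. Qed.

Lemma intg_dist g h : unitval g -> unitval h ->
  intg (fun t => `|g t - h t| * w t).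
Proof.
move=> [mg g01] [mh h01]; apply: (@intgM_bounded _ _ _ 1) => //.
  by apply: measurableT_comp => //; exact: measurable_funB.
move=> t; rewrite normr_id ler_norml.
by move: (g01 t) (h01 t) => /andP[? ?] /andP[? ?]; apply/andP; split; lra.
Qed.

Lemma apx_rtrig u : rtrig u -> (forall t, 0 <= u t <= 1) -> apx u.
Proof.
move=> ru u01 e e0; exists u; split => //.
under eq_Rintegral do rewrite subrr normr0 mul0r.
by rewrite Int_cst ltW.
Qed.

Lemma apx_onem g : apx g -> apx (fun t => 1 - g t).
Proof.
move=> ag e e0; have [u [ru u01 ug]] := ag e e0.
exists (fun t => 1 - u t); split; first exact: rtrig_onem.
  by move=> t; move: (u01 t); lra.
rewrite (eq_Int (v := fun t => `|u t - g t| * w t))// => t.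
by rewrite -normrN; congr (`|_| * _); ring.
Qed.

(** From u v - g h = (u - g) v + g (v - h), where [v] and [g] are bounded by 1, the two errors add
    up. *)
Lemma apxM g h : unitval g -> unitval h -> apx g -> apx h ->
  apx (fun t => g t * h t).
Proof.
move=> ug uh ag ah e e0; have e20 : 0 < e / 2 by rewrite divr_gt0.
have [u [ru u01 ugle]] := ag _ e20; have [v [rv v01 vhle]] := ah _ e20.
have uv01 t : 0 <= u t * v t <= 1.
  by move: (u01 t) (v01 t) => /andP[? ?] /andP[? ?]; rewrite mulr_ge0 ?mulr_ile1.
exists (fun t => u t * v t); split => //; first exact: rtrigM.
have iu := intg_dist (unitval_rtrig ru u01) ug.
have iv := intg_dist (unitval_rtrig rv v01) uh.
apply: (@le_trans _ _ (Int (fun t => `|u t - g t| * w t + `|v t - h t| * w t))).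
  apply: le_Int.
  - apply: intg_dist; first by apply: unitval_rtrig => //; exact: rtrigM.
    have [mg g01] := ug; have [mh h01] := uh.
    split; first exact: measurable_funM.
    by move=> t; move: (g01 t) (h01 t) => /andP[? ?] /andP[? ?];
      rewrite mulr_ge0 ?mulr_ile1.
  - exact: intgD.
  move=> t; rewrite -mulrDl ler_wpM2r//.
  have -> : u t * v t - g t * h t = (u t - g t) * v t + g t * (v t - h t) by ring.
  rewrite (le_trans (ler_normD _ _))// !normrM lerD//.
    by rewrite ler_piMr// ger0_norm; move: (v01 t) => /andP[].
  by rewrite ler_piMl// ger0_norm; move: (ug.2 t) => /andP[].
rewrite IntD//; lra.
Qed.

(** Since the [g_ n] lie between 0 and 1, [w] dominates every [g_ n t * w t]. Dominated convergence
    brings some [g_ n] within eps / 2 of [g], and an approximant of that [g_ n] serves for [g]. *)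
Lemma apx_lim (g_ : nat -> T -> R) g : (forall n, unitval (g_ n)) -> unitval g ->
  (forall n, apx (g_ n)) -> {ae mu, forall t, g_ n t @[n --> \oo] --> g t} ->
  apx g.
Proof.
move=> ug_ ug ag_ gg e e0; have e20 : 0 < e / 2 by rewrite divr_gt0.
have mw := intg_measurable iw.
have [ug_m ug_01] : (forall n, measurable_fun [set: T] (g_ n)) /\
    forall n t, 0 <= g_ n t <= 1 by split => n; case: (ug_ n).
have [_ cv _] : [/\ mu.-integrable [set: T] (fun t => (g t * w t)%:E),
    [sequence \int[mu]_x `|(g_ n x * w x)%:E - (g x * w x)%:E|]_n @ \oo --> 0 &
    [sequence \int[mu]_x (g_ n x * w x)%:E]_n @ \oo -->
      \int[mu]_x (g x * w x)%:E]%E.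
  apply: (@dominated_convergence _ _ _ mu _ _ _ _ (fun t => (w t)%:E)) => //.
  - by move=> n; apply/measurable_EFinP; exact: measurable_funM.
  - by apply/measurable_EFinP; apply: measurable_funM => //; case: ug.
  - apply: filterS gg => t gt _; apply: cvg_EFin; first exact: nearW.
    exact: cvgM gt (cvg_cst _).
  - apply: nearW => t n _; rewrite lee_fin normrM (ger0_norm (w0 t)).
    by have /andP[? ?] := ug_01 n t; rewrite ler_piMl// ger0_norm.
have {cv} /fine_cvg : [sequence (Int (fun t => `|g_ n t - g t| * w t))%:E]_n
    @ \oo --> (0 : R)%:E.
  apply: cvg_trans cv; apply: near_eq_cvg; apply: nearW => n /=.
  rewrite -Int_EFin; last exact: intg_dist.
  apply: eq_integral => t _; rewrite /= -mulrBl normrM.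
  by rewrite (ger0_norm (w0 t)).
move=> /cvgr_lt /(_ _ e20) [n _ /(_ n (leqnn n)) /= gn].
have [u [ru u01 ugn]] := ag_ n _ e20; exists u; split => //.
have iu := intg_dist (unitval_rtrig ru u01) (ug_ n).
have ig := intg_dist (ug_ n) ug.
apply: (@le_trans _ _ (Int (fun t => `|u t - g_ n t| * w t + `|g_ n t - g t| * w t))).
  apply: le_Int; [exact: intg_dist (unitval_rtrig ru u01) ug|exact: intgD|].
  by move=> t; rewrite -mulrDl ler_wpM2r// ler_distD.
by rewrite IntD//; lra.
Qed.

Lemma apx_ae g h : unitval g -> unitval h -> {ae mu, forall t, g t = h t} ->
  apx g -> apx h.
Proof.
move=> ug uh gh ag; apply: (@apx_lim (fun=> g)) => //.
by apply: filterS gh => t ->; exact: cvg_cst.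
Qed.

Lemma unitval_indic A : measurable A -> unitval \1_A.
Proof.
move=> mA; split; first exact: measurable_indic.
by move=> t; rewrite indicE; case: (t \in A); rewrite ?lexx ?ler01.
Qed.

Lemma unitval_onem g : unitval g -> unitval (fun t => 1 - g t).
Proof.
move=> [mg g01]; split; first by apply: measurable_funB => //.
by move=> t; move: (g01 t); lra.
Qed.

(** The measure lives on [0, 1], where the exceptional set is contained in {0, 1, x}, a finite set
    and hence null. *)
Lemma ae_circ (x : R) (Q : R -> Prop) :
  (forall t, 0 < t < 1 -> t != x -> Q t) -> {ae mu, forall t, Q t}.
Proof.
move=> Qt; exists (~` `]0%R, 1%R[ `|` [set x]); split.
- by apply: measurableU => //; apply: measurableC; exact: measurable_itv.
- rewrite /circ_mu /= /mrestr.
  apply: (@subset_measure0 _ _ _ lebesgue_measure _ ([set 0%R; 1%R] `|` [set x])) => //.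
  + apply: measurableI; last exact: measurable_itv.
    by apply: measurableU => //; apply: measurableC; exact: measurable_itv.
  + by do 2 apply: measurableU => //.
  + move=> t /= [[|tx]]; last by right.
    rewrite !in_itv/= => /negP; rewrite negb_and -!leNgt => /orP[] t0 /andP[t1 t2].
      by left; left; apply/eqP; rewrite eq_le t0.
    by left; right; apply/eqP; rewrite eq_le t0 t2.
  + apply: countable_lebesgue_measure0; apply: finite_set_countable.
    by rewrite !finite_setU; split; [split|]; exact: finite_set1.
- move=> t /= nQ; apply: contrapT => /not_orP[/contrapT]; rewrite /= in_itv/=.
  by move=> t01 /eqP tx; apply: nQ; exact: Qt.
Qed.

(** For x outside [0, 1) the indicator is constant almost everywhere on the circle. Otherwise it is
    the almost everywhere limit of the step polynomials composed with a trigonometric polynomial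
    that crosses 1/2 at x. *)
Lemma apx_ray (x : R) : apx \1_(`]x, +oo[%classic : set T).
Proof.
have mA : measurable (`]x, +oo[%classic : set T) by exact: measurable_itv.
have uA := unitval_indic mA.
have ucst c : 0 <= c <= 1 -> unitval (fun=> c) by move=> c01; split.
have [x0|x0] := ltP x 0.
  apply: (@apx_ae (fun=> 1)) => //; first by apply: ucst; rewrite ler01 lexx.
    apply: (@ae_circ 0) => t /andP[t0 t1] _; rewrite indicE mem_set//=.
    by rewrite in_itv/= andbT (lt_trans x0).
  by apply: apx_rtrig; [exact: rtrig_cst|move=> _; rewrite ler01 lexx].
have [x1|x1] := leP 1 x.
  apply: (@apx_ae (fun=> 0)) => //; first by apply: ucst; rewrite ler01 lexx.
    apply: (@ae_circ 0) => t /andP[t0 t1] _; rewrite indicE memNset//=.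
    by rewrite in_itv/= andbT; apply/negP; rewrite -leNgt (le_trans _ x1)// ltW.
  by apply: apx_rtrig; [exact: rtrig_cst|move=> _; rewrite ler01 lexx].
(* By the sign of the sine product, on (0, 1) [v] is above 1/2 to the left of x and below 1/2 to its
   right. *)
pose v (t : T) : R := (1 + - (sin (pi * t) * sin (pi * (t - x)))) / 2.
have rv : rtrig v.
  apply: rtrig_ext (rtrigM (rtrig_onem (rtrig_sin_sin x)) (rtrig_cst 2^-1)).
  by [].
have v01 t : 0 <= v t <= 1.
  have : `|sin (pi * t) * sin (pi * (t - x))| <= 1.
    by rewrite normrM mulr_ile1// ?sin_max.
  by rewrite ler_norml /v; lra.
have rs n : rtrig (fun t => step n (v t)).
  by apply: rtrigX; apply: rtrig_onem; exact: rtrigX.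
have s01 n t : 0 <= step n (v t) <= 1 by exact: step01.
apply: (@apx_lim (fun n t => step n (v t))) => //.
- by move=> n; exact: unitval_rtrig.
- by move=> n; exact: apx_rtrig.
apply: (@ae_circ x) => t /andP[t0 t1] tx.
have p0 := pi_gt0 R.
have st : 0 < sin (pi * t) by apply: sin_gt0_pi; rewrite mulr_gt0//= gtr_pMr.
move: tx; rewrite neq_lt => /orP[tx|xt].
- rewrite indicE memNset; last first.
    by rewrite /= in_itv/= andbT; apply/negP; rewrite -leNgt ltW.
  apply: cvg_step_gt; rewrite (andP (v01 t)).2 andbT /v.
  have : 0 < sin (pi * (x - t)).
    apply: sin_gt0_pi; rewrite mulr_gt0 ?subr_gt0//= gtr_pMr//; lra.
  rewrite -opprB mulrN sinN oppr_gt0 => s2.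
  have : 0 < sin (pi * t) * - sin (pi * (t - x)) by rewrite mulr_gt0// oppr_gt0.
  lra.
- rewrite indicE mem_set; last by rewrite /= in_itv/= andbT.
  apply: cvg_step_lt; rewrite (andP (v01 t)).1 /= /v.
  have : 0 < sin (pi * (t - x)).
    apply: sin_gt0_pi; rewrite mulr_gt0 ?subr_gt0//= gtr_pMr//; lra.
  move=> s2; have := mulr_gt0 st s2; lra.
Qed.

Definition apx_sets : set (set T) := [set A | measurable A /\ apx \1_A].

(** For countable unions, pass to complements: the indicator of the complement of the union is the
    pointwise limit of the finite products of the 1 - [\1_(F k)], which are covered by [apxM]. At
    each point these products are eventually constant. *)
Lemma apx_sets_sigma_algebra : sigma_algebra [set: T] apx_sets.
Proof.
split.
- split; first exact: measurable0.
  rewrite indic0; apply: apx_rtrig; first exact: rtrig_cst.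
  by move=> t; rewrite /= lexx ler01.
- move=> A [mA aA]; split; first exact: measurableD.
  have -> : \1_([set: T] `\` A) = (fun t => 1 - \1_A t) :> (T -> R).
    apply/funext => t; rewrite setTD !indicE in_setC.
    by case: (t \in A); rewrite /= ?subrr ?subr0.
  exact: apx_onem.
- move=> F FA; have mF k : measurable (F k) by case: (FA k).
  have mU : measurable (\bigcup_k F k) by exact: bigcupT_measurable.
  split => //.
  have -> : \1_(\bigcup_k F k) = (fun t => 1 - (1 - \1_(\bigcup_k F k) t)) :> (T -> R).
    by apply/funext => t; rewrite subKr.
  apply: apx_onem.
  pose p n (t : T) : R := \prod_(k < n) (1 - \1_(F k) t).
  have up n : unitval (p n) /\ apx (p n).
    elim: n => [|n [un an]].
      have -> : p 0%N = fun=> 1 by apply/funext => t; rewrite /p big_ord0.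
      split; first by split=> // t; rewrite ler01 lexx.
      by apply: apx_rtrig; [exact: rtrig_cst|move=> t; rewrite ler01 lexx].
    have -> : p n.+1 = fun t => p n t * (1 - \1_(F n) t).
      by apply/funext => t; rewrite /p big_ord_recr.
    have uF : unitval (fun t => 1 - \1_(F n) t).
      exact/unitval_onem/unitval_indic.
    split; last by apply: apxM => //; apply: apx_onem; case: (FA n).
    have [mn n01] := un; have [mF' F01] := uF.
    split; first exact: measurable_funM.
    by move=> t; move: (n01 t) (F01 t) => /andP[? ?] /andP[? ?];
      rewrite mulr_ge0 ?mulr_ile1.
  apply: (@apx_lim p).
  + by move=> n; case: (up n).
  + exact/unitval_onem/unitval_indic.
  + by move=> n; case: (up n).
  apply: nearW => t.
  have [[k _ Fk]|nF] := pselect ((\bigcup_k F k) t).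
    rewrite indicE mem_set ?subrr; last by exists k.
    apply: cvg_near_cst; exists k.+1 => // n /= kn.
    by rewrite /p (bigD1 (Ordinal kn))//= indicE mem_set// subrr mul0r.
  rewrite indicE memNset// subr0.
  apply: cvg_near_cst; apply: nearW => n; rewrite /p big1// => k _.
  by rewrite indicE memNset ?subr0// => Fk; apply: nF; exists k.
Qed.

(** The open rays generate the Borel sets, so the sigma-algebra [apx_sets] contains them all. *)
Lemma apx_measurable A : measurable A -> apx \1_A.
Proof.
have : measurable `<=` apx_sets.
  have -> : (measurable : set (set T)) = (@RGenOInfty.G R).-sigma.-measurable.
    exact: RGenOInfty.measurableE.
  apply: smallest_sub; first exact: apx_sets_sigma_algebra.
  move=> _ [x ->]; split; first exact: measurable_itv.
  exact: apx_ray.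
by move=> sub mA; case: (sub A mA).
Qed.


End approximation.

(** * Two inequalities for the exponential *)

Section exponential_bounds.
Variable R : realType.

(** After squaring, this is 1 + s <= exp s with s = 2 Re y + |y|^2. *)
Lemma cabs1D_le (y : R[i]) :
  cabs (1 + y) <= expR (complex.Re y + cabs y ^+ 2 / 2).
Proof.
rewrite -(@ler_pXn2r _ 2) ?nnegrE ?cabs_ge0 ?expR_ge0// -expRM_natl.
apply: le_trans (expR_ge1Dx _).
rewrite !sqr_cabs ReD ImD /=.
by rewrite le_eqVlt; apply/orP; left; apply/eqP; field.
Qed.

(** By convexity, exp lies below its chord between 0 and [l]. *)
Lemma expR_chord (l s : R) : 0 <= s <= 1 ->
  expR (l * s) <= 1 + (expR l - 1) * s.
Proof.
move=> /andP[s0 s1]; have := convex_expR (Itv01 s0 s1) l 0.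
rewrite !convRE /= mulr0 addr0 expR0 mulr1 mulrC => /le_trans; apply.
by rewrite /unstable.onem; lra.
Qed.

End exponential_bounds.

(** * The uniqueness theorem of F. and M. Riesz *)

Section riesz_uniqueness.
Variable R : realType.
Local Notation mu := (circ_mu R).
Local Notation T := (measurableTypeR R).
Local Notation Int u := (\int[mu]_x u x).
Implicit Types (f : T -> R[i]) (u v : T -> R) (P : {poly R[i]}) (E : set T).

Lemma intg_expR_poly (l : R) P f : cintg f ->
  intg (fun t => expR (l * complex.Re P.[zeta t]) * cabs (f t)).
Proof.
move=> cf; have [M M0 PM] := poly_zeta_bounded P.
apply: (@intgM_bounded _ _ _ (expR (`|l| * M))); last exact: cintg_cabs.
  apply: measurableT_comp => //; apply: measurable_funM => //.
  by case: (cmeasurable_poly P).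
move=> t; rewrite ger0_norm ?expR_ge0// ler_expR (le_trans (ler_norm _))//.
by rewrite normrM ler_wpM2l// (le_trans (norm_Re_le_cabs _)).
Qed.

(* The polynomial (1 + l (P - P(0)) / n)^n takes the value 1 at the origin and
   imitates exp (l (P - P(0))), so multiplying f by it preserves the mean of f
   while reweighting |f| by exp (l Re (P - P(0))). *)
Lemma mean_le_expR_weight (l : R) P f : cintg f ->
  (forall k, cintegral (fun t => zeta t ^+ k.+1 * f t) = 0) ->
  let K := expR (2^-1 - l * complex.Re P.[0]) *
           Int (fun t => expR (l * complex.Re P.[zeta t]) * cabs (f t)) in
  `|complex.Re (cintegral f)| <= K /\ `|complex.Im (cintegral f)| <= K.
Proof.
move=> cf f0 K; pose c := P.[0].
pose W : {poly R[i]} := (l%:C)%C *: (P - c%:P).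
have [B B0 WB] := poly_zeta_bounded W.
(* With n >= B^2 the second-order error n |W / n|^2 / 2 = |W|^2 / (2 n) is at most 1/2; this is the
   [2^-1] in [K]. *)
pose n := (Num.truncn (B ^+ 2)).+1.
have nB : B ^+ 2 <= n%:R by rewrite ltW// truncnS_gt.
have n0 : 0 < n%:R :> R by rewrite ltr0n.
pose Q : {poly R[i]} := (1 + (n%:R^-1)%:C%C *: W) ^+ n.
have Q0 : Q.[0] = 1.
  by rewrite /Q horner_exp hornerD hornerZ hornerZ hornerD hornerN !hornerC subrr
     !mulr0 addr0 expr1n.
have ReW t : complex.Re W.[zeta t] =
    l * complex.Re P.[zeta t] - l * complex.Re c.
  rewrite /W hornerZ hornerD hornerN hornerC.
  case: (P.[zeta t]) => a b; case: (c) => a' b' /=.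
  by rewrite mul0r subr0 mulrBr.
have QW t : cabs Q.[zeta t] <=
    expR (2^-1 - l * complex.Re c) * expR (l * complex.Re P.[zeta t]).
  rewrite /Q horner_exp hornerD hornerZ hornerC cabsX -expRD.
  set y := _ * W.[_].
  apply: (@le_trans _ _ (expR (complex.Re y + cabs y ^+ 2 / 2) ^+ n)).
    by rewrite ler_pXn2r ?nnegrE ?cabs_ge0 ?expR_ge0// cabs1D_le.
  rewrite -expRM_natl ler_expR.
  have Rey : complex.Re y = n%:R^-1 * complex.Re W.[zeta t].
    by rewrite /y ReM /= mul0r subr0.
  have cy : cabs y = n%:R^-1 * cabs W.[zeta t].
    rewrite /y cabsM; congr (_ * _); rewrite /cabs /= expr0n addr0 sqrtr_sqr.
    by rewrite ger0_norm// invr_ge0 ltW.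
  rewrite mulrDr Rey mulVKf ?gt_eqF// cy ReW.
  have : n%:R * ((n%:R^-1 * cabs W.[zeta t]) ^+ 2 / 2) <= 2^-1.
    have -> : n%:R * ((n%:R^-1 * cabs W.[zeta t]) ^+ 2 / 2) =
       (cabs W.[zeta t] ^+ 2 / n%:R) / 2 by field; rewrite gt_eqF.
    rewrite ler_pdivrMr// mulVf// ler_pdivrMr// mul1r (le_trans _ nB)//.
    by rewrite ler_pXn2r ?nnegrE ?cabs_ge0.
  lra.
have iK := intg_expR_poly l P cf.
have [cQ1 cQ2] := cintgM_poly Q cf.
have QfK t : cabs (Q.[zeta t] * f t) <= expR (2^-1 - l * complex.Re c) *
    (expR (l * complex.Re P.[zeta t]) * cabs (f t)).
  by rewrite cabsM mulrA ler_wpM2r// cabs_ge0.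
have <- : cintegral (fun t => Q.[zeta t] * f t) = cintegral f.
  by rewrite cintegral_poly_mul// Q0 mul1r.
rewrite /K -IntZ//; split; apply: norm_Int_le => //; try exact: intgZ.
  by move=> t; rewrite (le_trans (norm_Re_le_cabs _)).
by move=> t; rewrite (le_trans (norm_Im_le_cabs _)).
Qed.

Lemma Int_indic E : measurable E -> (Int \1_E)%:E = mu E.
Proof.
move=> mE; rewrite -Int_EFin.
  by rewrite integral_indic// setIT.
have [m01 h01] := @unitval_indic R _ mE.
by apply: (@intg_bounded _ _ 1) => // t; rewrite ger0_norm; case/andP: (h01 t).
Qed.

(* Take Re P close to the indicator of E in L^1((1 + |f|) dm): the weight
   exp (l Re P) is then harmless where f lives, while the factor
   exp (- l Re P(0)) is about exp (- l m(E)). *)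
Lemma mean_eq0_of_vanishing f E : cintg f -> measurable E -> (0 < mu E)%E ->
  (forall t, E t -> f t = 0) ->
  (forall k, cintegral (fun t => zeta t ^+ k.+1 * f t) = 0) ->
  cintegral f = 0.
Proof.
move=> cf mE; rewrite -Int_indic// lte_fin; set e := Int _ => e0 fE f0.
pose w t := 1 + cabs (f t).
have icf := cintg_cabs cf.
have iw : intg w by apply: intgD => //; exact: intg_cst.
have w0 t : 0 <= w t by rewrite addr_ge0// cabs_ge0.
pose F := Int (fun t => cabs (f t)).
have F0 : 0 <= F by apply: Int_ge0 => t; exact: cabs_ge0.
have uE := unitval_indic mE.
(* The factor exp (1/2) is the loss in [mean_le_expR_weight], and F + 1 will bound the reweighted
   mass of |f|. *)
pose C := expR 2^-1 * (F + 1).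
have C0 : 0 < C by rewrite mulr_gt0 ?expR_gt0//; lra.
suff bound (l : R) : 0 < l ->
    `|complex.Re (cintegral f)| <= expR (- (l * (e / 2))) * C /\
    `|complex.Im (cintegral f)| <= expR (- (l * (e / 2))) * C.
  have small (a : R) : 0 <= a ->
      (forall l, 0 < l -> a <= expR (- (l * (e / 2))) * C) -> a = 0.
    move=> a0 ale; apply/eqP/contraT => an0.
    have {an0} a1 : 0 < a by rewrite lt0r an0.
    have e20 : 0 < e / 2 by rewrite divr_gt0.
    (* This choice gives a (1 + l e / 2) = a + C > C, whereas the assumed bound forces a exp (l e /
       2) <= C. *)
    pose l := C / (a * (e / 2)).
    have l0 : 0 < l by rewrite divr_gt0// mulr_gt0.
    have := ale _ l0; rewrite expRN mulrC ler_pdivlMr ?expR_gt0//.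
    apply: contraLR => _; rewrite -ltNge.
    apply: (@lt_le_trans _ _ (a * (1 + l * (e / 2)))).
      have -> : a * (1 + l * (e / 2)) = a + C.
        by rewrite /l; field; rewrite !gt_eqF.
      by rewrite ltrDr.
    by rewrite ler_wpM2l// expR_ge1Dx.
  apply: eq_ReIm; apply/eqP; rewrite -normr_eq0; apply/eqP; apply: small => //.
    by move=> l /bound[].
  by move=> l /bound[].
move=> l0.
(* The bound e / 2 keeps the mean of [u] at least e / 2; the bound exp (- l) offsets the factor exp
   l - 1 coming from the chord inequality. *)
pose d := Num.min (e / 2) (expR (- l)).
have d0 : 0 < d by rewrite lt_min divr_gt0//= expR_gt0.
have [u [[P uP] u01 ud]] := apx_measurable iw w0 mE d0.
have ru : rtrig u by exists P.
have uu := unitval_rtrig ru u01.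
have iu : intg u.
  apply: (@intg_bounded _ _ 1); first exact: rtrig_measurable.
  by move=> t; rewrite ger0_norm; case/andP: (u01 t).
have iE : intg \1_E.
  apply: (@intg_bounded _ _ 1); first by case: uE.
  by move=> t; rewrite ger0_norm; case/andP: (uE.2 t).
have idw := intg_dist iw uu uE.
(* By the mean value property, Re P(0) is the mean of [u], which is within [d] of [e]. *)
have meanu : e / 2 <= complex.Re P.[0].
  rewrite -Int_rtrig -(eq_Int uP).
  suff : e - Int u <= d.
    have : d <= e / 2 by rewrite ge_min lexx.
    lra.
  rewrite -IntB//; apply: le_trans ud; apply: le_Int => //; first exact: intgB.
  move=> t; rewrite distrC (le_trans (ler_norm _))// ler_peMr//.
  by rewrite lerDl cabs_ge0.
have iuf : intg (fun t => u t * cabs (f t)).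
  apply: (@intgM_bounded _ _ _ 1) => //; first exact: rtrig_measurable.
  by move=> t; rewrite ger0_norm; case/andP: (u01 t).
(* On [E] the function [f] vanishes; off [E] the indicator is 0, so u |f| is part of the
   approximation error. *)
have ufd : Int (fun t => u t * cabs (f t)) <= d.
  apply: le_trans ud; apply: le_Int => // t.
  have /andP[u0 u1] := u01 t; rewrite indicE.
  have [tE|tE] := boolP (t \in E).
    have ft0 : f t = 0 by apply: fE; exact: set_mem.
    by rewrite ft0 cabs0 mulr0 mulr_ge0.
  by rewrite subr0 ger0_norm// ler_wpM2l// lerDr.
(* Integrate exp (l u) <= 1 + (exp l - 1) u against |f|; the second term contributes at most (exp l
   - 1) exp (- l) <= 1. *)
have weight : Int (fun t => expR (l * complex.Re P.[zeta t]) * cabs (f t)) <= F + 1.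
  apply: (@le_trans _ _ (Int (fun t => cabs (f t) + (expR l - 1) * (u t * cabs (f t))))).
    apply: le_Int; first exact: intg_expR_poly.
      by apply: intgD => //; exact: intgZ.
    move=> t; rewrite mulrA -[X in X + _]mul1r -mulrDl ler_wpM2r ?cabs_ge0//.
    by rewrite -uP expR_chord.
  rewrite IntD//; last exact: intgZ.
  rewrite IntZ// lerD2l.
  have el1 : 0 <= expR l - 1 by have := expR_ge1Dx l; lra.
  apply: (@le_trans _ _ ((expR l - 1) * expR (- l))).
    by rewrite ler_wpM2l// (le_trans ufd)// ge_min lexx orbT.
  rewrite mulrBl mul1r expRxMexpNx_1; have := expR_ge0 (- l); lra.
have [Hre Him] := mean_le_expR_weight l P cf f0.
have KC : expR (2^-1 - l * complex.Re P.[0]) *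
    Int (fun t => expR (l * complex.Re P.[zeta t]) * cabs (f t)) <=
    expR (- (l * (e / 2))) * C.
  rewrite /C mulrA -expRD ler_pM ?expR_ge0//.
    by apply: Int_ge0 => t; rewrite mulr_ge0 ?expR_ge0 ?cabs_ge0.
  by rewrite ler_expR addrC lerD2r lerN2 ler_wpM2l// ltW.
by split; [exact: le_trans Hre KC|exact: le_trans Him KC].
Qed.

(** Real parts of the moments show that [v] is orthogonal to every real trigonometric polynomial.
    Approximation with weight |v| extends this to indicators, and the indicator of {v >= 0} then
    gives mean |v| = 0. *)
Lemma fourier_eq0_ae v : intg v ->
  (forall k, cintegral (fun t => zeta t ^+ k * ((v t)%:C)%C) = 0) ->
  {ae mu, forall t, v t = 0}.
Proof.
move=> iv v0; have mv := intg_measurable iv; have inv := intg_norm iv.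
have cv : cintg (fun t => ((v t)%:C)%C) by split => //; exact: intg_cst.
have trig0 u : rtrig u -> Int (fun t => u t * v t) = 0.
  move=> [P uP].
  have : cintegral (fun t => P.[zeta t] * ((v t)%:C)%C) = 0.
    rewrite cintegral_poly_mul//.
    rewrite (_ : cintegral _ = 0) ?mulr0// -[RHS](v0 0%N).
    by apply: eq_cintegral => t; rewrite expr0 mul1r.
  move=> /(congr1 (@complex.Re R)) /= <-; apply: eq_Int => t.
  by rewrite uP ReM /= mulr0 subr0.
have indic0_int A : measurable A -> Int (fun t => \1_A t * v t) = 0.
  move=> mA; apply/eqP; rewrite -normr_eq0 -[_ == _]negbK.
  apply/negP => n0; have := apx_measurable inv (fun t => normr_ge0 (v t)) mA.
  set a := `|_| in n0 *; have a0 : 0 < a by rewrite lt0r n0 normr_ge0.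
  have a20 : 0 < a / 2 by rewrite divr_gt0.
  move=> /(_ _ a20)[u [ru u01 ua]].
  have uu := unitval_rtrig ru u01; have uA := unitval_indic mA.
  have bM g : unitval g -> intg (fun t => g t * v t).
    move=> [mg g01]; apply: (@intgM_bounded _ _ _ 1) => // t.
    by rewrite ger0_norm; case/andP: (g01 t).
  have : a <= a / 2.
    apply: le_trans ua.
    have -> : a = `|Int (fun t => \1_A t * v t - u t * v t)|.
      by rewrite IntB; [rewrite trig0// subr0|exact: bM..].
    apply: norm_Int_le.
    - by apply: intgB; exact: bM.
    - by have := intg_dist inv uu uA.
    - by move=> t; rewrite -mulrBl normrM distrC.
  lra.
pose A : set T := [set t | 0 <= v t].
have mA : measurable A.
  have -> : A = v @^-1` `[0, +oo[%classic.
    by apply/seteqP; split => t /=; rewrite in_itv/= andbT.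
  by rewrite -[X in measurable X]setTI; apply: mv => //; exact: measurable_itv.
have iA : intg (fun t => \1_A t * v t).
  have [mA1 A01] := unitval_indic mA.
  apply: (@intgM_bounded _ _ _ 1) => // t.
  by rewrite ger0_norm; case/andP: (A01 t).
have : Int (fun t => `|v t|) = 0.
  (* With A = {v >= 0}, |v| = 2 [\1_A] v - v, and both terms have mean zero. *)
  rewrite (eq_Int (v := fun t => 2 * (\1_A t * v t) - v t)); last first.
    move=> t; rewrite indicE; have [vt|vt] := leP 0 (v t).
      by rewrite ger0_norm// mem_set//= mul1r mulr_natl mulr2n addrK.
    rewrite ltr0_norm// memNset/= ?mul0r ?mulr0 ?sub0r//.
    by apply/negP; rewrite -ltNge.
  rewrite IntB//; last exact: intgZ.
  rewrite IntZ// indic0_int// mulr0 sub0r; apply/eqP; rewrite oppr_eq0; apply/eqP.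
  rewrite -[RHS](indic0_int setT)//; apply: eq_Int => t.
  by rewrite indicT mul1r.
move=> /(Int_eq0_ae inv) h; have {h} := h (fun t => normr_ge0 (v t)).
by apply: filterS => t /eqP; rewrite normr_eq0 => /eqP.
Qed.

(** The real case is applied to Re f and to Im f = Re (- i f). *)
Lemma cfourier_eq0_ae f : cintg f ->
  (forall k, cintegral (fun t => zeta t ^+ k * f t) = 0) ->
  (forall k, cintegral (fun t => conjc (zeta t) ^+ k * f t) = 0) ->
  {ae mu, forall t, f t = 0}.
Proof.
have main g : cintg g ->
    (forall k, cintegral (fun t => zeta t ^+ k * g t) = 0) ->
    (forall k, cintegral (fun t => conjc (zeta t) ^+ k * g t) = 0) ->
    {ae mu, forall t, complex.Re (g t) = 0}.
  move=> cg g1 g2; apply: fourier_eq0_ae; first by case: cg.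
  move=> k; pose p t := zeta t ^+ k * g t.
  pose q t := conjc (zeta t) ^+ k * g t.
  have [p1 p2] : cintg p by exact: cintgM_zetaX.
  have [q1 q2] : cintg q by exact: cintgM_conj_zetaX.
  have [P1 P2] : Int (fun t => complex.Re (p t)) = 0 /\
      Int (fun t => complex.Im (p t)) = 0.
    by have := g1 k => -[].
  have [Q1 Q2] : Int (fun t => complex.Re (q t)) = 0 /\
      Int (fun t => complex.Im (q t)) = 0.
    by have := g2 k => -[].
  (* This is z^k Re g = (p + conj q) / 2, which is why moments of both signs are required of [g]. *)
  have pq t : zeta t ^+ k * ((complex.Re (g t))%:C)%C =
      Complex (2^-1 * (complex.Re (p t) + complex.Re (q t)))
              (2^-1 * (complex.Im (p t) - complex.Im (q t))).
    rewrite /p /q -conjcX; case: (zeta t ^+ k) => a b; case: (g t) => c d /=.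
    by apply: eq_ReIm; rewrite ?ReM ?ImM/=; field.
  apply: eq_ReIm => /=.
    rewrite (eq_Int (v := fun t => 2^-1 * (complex.Re (p t) + complex.Re (q t)))).
      by rewrite (IntZ _ (intgD p1 q1)) (IntD p1 q1) P1 Q1 addr0 mulr0.
    by move=> t; rewrite pq.
  rewrite (eq_Int (v := fun t => 2^-1 * (complex.Im (p t) - complex.Im (q t)))).
    by rewrite (IntZ _ (intgB p2 q2)) (IntB p2 q2) P2 Q2 subr0 mulr0.
  by move=> t; rewrite pq.
move=> cf f1 f2; have re0 := main _ cf f1 f2.
pose J : R[i] := Complex 0 (-1).
have cJ (z : T -> R[i]) : cintg (fun t => z t * f t) ->
    cintegral (fun t => z t * f t) = 0 ->
    cintegral (fun t => z t * (J * f t)) = 0.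
  move=> cz z0; rewrite (eq_cintegral (g := fun t => J * (z t * f t))).
    by rewrite cintegralZ// z0 mulr0.
  by move=> t; rewrite mulrCA.
have im0 : {ae mu, forall t, complex.Re (J * f t) = 0}.
  apply: main; first exact: cintgZ.
  - by move=> k; apply: cJ; [exact: cintgM_zetaX|exact: f1].
  - by move=> k; apply: cJ; [exact: cintgM_conj_zetaX|exact: f2].
apply: filterS2 re0 im0 => t; case: (f t) => a b /= -> /=.
by rewrite mul0r mulN1r opprK add0r => ->.
Qed.

(** Strong induction on k shows that conj z^k f has mean zero. It still vanishes on [E], and its
    positive moments are either positive moments of [f] or means of conj z^i f with i < k, so
    [mean_eq0_of_vanishing] applies. All Fourier coefficients of [f] are then zero. *)
Lemma riesz_uniqueness f E : cintg f -> measurable E -> (0 < mu E)%E ->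
  (forall t, E t -> f t = 0) ->
  (forall k, cintegral (fun t => zeta t ^+ k.+1 * f t) = 0) ->
  {ae mu, forall t, f t = 0}.
Proof.
move=> cf mE E0 fE f0.
have conj0 k : cintegral (fun t => conjc (zeta t) ^+ k * f t) = 0.
  elim/ltn_ind: k => k IH.
  apply: mean_eq0_of_vanishing (cintgM_conj_zetaX k cf) mE E0 _ _.
    by move=> t /fE ->; rewrite mulr0.
  move=> j; have [kj|jk] := ltnP k j.+1.
    rewrite -[RHS](f0 (j - k)%N); apply: eq_cintegral => t.
    rewrite -subSn// mulrA; congr (_ * _).
    by rewrite -{1}(subnK (ltnW kj)) exprD -mulrA -exprMn zeta_conjK expr1n mulr1.
  rewrite -[RHS](IH (k - j.+1)%N); last by rewrite ltn_subrL/= (leq_trans _ jk).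
  apply: eq_cintegral => t; rewrite mulrA; congr (_ * _).
  rewrite -{1}(subnK jk) exprD mulrC -mulrA -exprMn mulrC.
  by rewrite [conjc _ * _]mulrC zeta_conjK expr1n mul1r.
apply: (cfourier_eq0_ae cf _ conj0) => -[|k]; last exact: f0.
by rewrite -[RHS](conj0 0%N); apply: eq_cintegral => t; rewrite !expr0.
Qed.

End riesz_uniqueness.

(** * L^2 norms, nonvanishing in H^2, and the projection onto conj H^2 *)

Section hankel.
Variable R : realType.
Local Notation mu := (circ_mu R).
Local Notation T := (measurableTypeR R).
Local Notation Int u := (\int[mu]_x u x).
Implicit Types (f g h phi : T -> R[i]) (u v : T -> R).

Lemma ae_eq_Int u v : intg u -> intg v -> {ae mu, forall t, u t = v t} ->
  Int u = Int v.
Proof.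
move=> iu iv uv; congr fine; apply: ae_eq_integral => //.
- exact: measurable_int iu.
- exact: measurable_int iv.
- by apply: filterS uv => t -> _.
Qed.

Lemma inL2_intg f : inL2 f -> intg (fun t => cabs (f t) ^+ 2).
Proof.
move=> [mf Lf]; apply/integrableP; split.
  by apply/measurable_EFinP; apply: measurable_funX; exact: cmeasurable_cabs.
have := @poweR_lty _ _ 2 Lf; rewrite /Lpnorm poweR_Lnorm ?pnatr_eq0//.
apply: le_lt_trans; rewrite le_eqVlt; apply/orP; left; apply/eqP.
apply: eq_integral => t _ /=.
rewrite ger0_norm ?sqr_ge0// ger0_norm ?cabs_ge0//.
by rewrite powR_mulrn ?cabs_ge0.
Qed.

Lemma Lpnorm2E f : intg (fun t => cabs (f t) ^+ 2) ->
  Lpnorm 2%:E f = (Num.sqrt (Int (fun t => cabs (f t) ^+ 2)))%:E.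
Proof.
move=> i2; rewrite /Lpnorm unlock.
under eq_integral => t _.
  rewrite abse_EFin poweR_EFin (ger0_norm (cabs_ge0 _)) powR_mulrn ?cabs_ge0//.
  over.
rewrite Int_EFin// poweR_EFin powR12_sqrt//.
by apply: Int_ge0 => t; rewrite sqr_ge0.
Qed.

Lemma inL2_conjc f : inL2 (fun t => conjc (f t)) -> inL2 f.
Proof.
move=> [mf Lf]; split.
  have := cmeasurable_conjc mf.
  by under eq_fun do rewrite conjcK.
apply: le_lt_trans Lf; rewrite /Lpnorm.
by under eq_Lnorm do rewrite -cabs_conjc.
Qed.

Lemma inL2_cintg f : inL2 f -> cintg f.
Proof.
move=> Lf; have i2 := inL2_intg Lf; have [mf _] := Lf.
apply: (@cintg_le _ _ (fun t => 1 + cabs (f t) ^+ 2)) => //; last first.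
  by apply: intgD => //; exact: intg_cst.
(* The square gives |f| <= |f|^2 + 1/4. *)
by move=> t; have := sqr_ge0 (cabs (f t) - 2^-1); lra.
Qed.

(** With the sign convention of [fourier], the coefficient of index -(k + 1) is the moment against
    z^(k + 1). *)
Lemma inH2_moments f : inH2 f ->
  forall k, cintegral (fun t => zeta t ^+ k.+1 * f t) = 0.
Proof.
move=> [_ f0] k; rewrite -[RHS](f0 (- (k.+1%:Z)))//.
apply: eq_cintegral => t; rewrite mulrC zetaX; congr (_ * expi _).
by rewrite mulrNz mulrN mulNr opprK.
Qed.

(** A zero set of positive measure would force f = 0 almost everywhere by [riesz_uniqueness],
    against the positive norm. *)
Lemma inH2_neq0_ae f : inH2 f -> 0 < Int (fun t => cabs (f t) ^+ 2) ->
  {ae mu, forall t, f t != 0}.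
Proof.
move=> Hf nf; have [Lf _] := Hf; have cf := inL2_cintg Lf.
have [mf _] := Lf; have i2 := inL2_intg Lf.
pose E : set T := [set t | f t = 0].
have mE : measurable E.
  have -> : E = (fun t => cabs (f t)) @^-1` [set 0].
    apply/seteqP; split => t /=; first by move=> ->; exact: cabs0.
    by move/eqP; rewrite cabs_eq0 => /eqP.
  rewrite -[X in measurable X]setTI; apply: cmeasurable_cabs => //.
have [E0|E0] := eqVneq (mu E) 0%E.
  by exists E; split => // t /= /negP/negPn/eqP.
have muE : (0 < mu E)%E by rewrite lt0e E0 measure_ge0.
have f0 := riesz_uniqueness cf mE muE (fun t => id) (inH2_moments Hf).
move: nf; rewrite (@ae_eq_Int _ (fun=> 0)) ?Int_cst ?ltxx//.
  exact: intg_cst.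
by apply: filterS f0 => t ->; rewrite cabs0 expr0n.
Qed.

(** As h - g is orthogonal to g, adding 2 Re ((h - g) conj g) to |g|^2 does not change the integral.
    The sum is |h|^2 - |h - g|^2, hence at most |h|^2 pointwise. *)
Lemma Pbar_norm_le h g : inL2 h -> is_Pbar h g ->
  Int (fun t => cabs (g t) ^+ 2) <= Int (fun t => cabs (h t) ^+ 2).
Proof.
move=> Lh [Hg orth]; have Lg := inL2_conjc (proj1 Hg).
have ih := inL2_intg Lh; have ig := inL2_intg Lg.
pose c t := complex.Re ((h t - g t) * conjc (g t)).
have c0 : Int c = 0 by have := orth g Hg => -[].
have [mh _] := Lh; have [mg _] := Lg.
have ic : intg c.
  apply: (@intg_le _ _ (fun t => cabs (h t) ^+ 2 + 2 * cabs (g t) ^+ 2)).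
  - have mNg : cmeasurable (fun t => h t - g t).
      apply: cmeasurableD => //; under eq_fun do rewrite -mulN1r.
      by apply: cmeasurableM => //; exact: cmeasurable_cst.
    by have [] := cmeasurableM mNg (cmeasurable_conjc mg).
  - move=> t; rewrite /c; case: (h t) => a b; case: (g t) => x y.
    rewrite !sqr_cabs ReM /= ler_norml.
    have := sqr_ge0 (a - x); have := sqr_ge0 (a + x).
    have := sqr_ge0 (b - y); have := sqr_ge0 (b + y).
    have := sqr_ge0 a; have := sqr_ge0 b; have := sqr_ge0 x; have := sqr_ge0 y.
    by move=> ? ? ? ? ? ? ? ?; apply/andP; split; lra.
  - by apply: intgD => //; exact: intgZ.
have -> : Int (fun t => cabs (g t) ^+ 2) = Int (fun t => cabs (g t) ^+ 2 + 2 * c t).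
  by rewrite (IntD ig (intgZ 2 ic)) (IntZ 2 ic) c0 mulr0 addr0.
apply: le_Int => //; first by apply: intgD => //; exact: intgZ.
move=> t; rewrite /c; case: (h t) => a b; case: (g t) => x y.
rewrite !sqr_cabs ReM /=.
by have := sqr_ge0 (a - x); have := sqr_ge0 (b - y); lra.
Qed.

(** The L^oo norm is an essential supremum on a space of positive measure; the total mass 1 ensures
    this. *)
Lemma Lpnorm_ooE phi : Lpnorm +oo%E phi = ess_sup mu (fun t => (cabs (phi t))%:E).
Proof.
rewrite /Lpnorm unlock circ_mu_setT lte01; congr ess_sup.
by apply/funext => t /=; rewrite ger0_norm ?cabs_ge0.
Qed.

End hankel.

(** * The equality case in the norm estimate *)

Theorem theorem2 (R : realType) (phi : measurableTypeR R -> R[i]) :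
  inH2 phi ->
  hankel_norm_attaining phi ->
  hankel_max_norm phi ->
  hankel_min_norm phi.
Proof.
move=> [Lphi _] [f [g [[[Hf Lh] Pg] [f1 normg]]]] max.
have Lg := inL2_conjc (proj1 (proj1 Pg)); have [Lf _] := Hf.
have ig := inL2_intg Lg; have if2 := inL2_intg Lf; have iphi := inL2_intg Lphi.
have ih := inL2_intg Lh.
rewrite /hankel_min_norm normg (Lpnorm2E ig) (Lpnorm2E iphi).
move: max; rewrite /hankel_max_norm normg (Lpnorm2E ig) Lpnorm_ooE.
move: f1; rewrite (Lpnorm2E if2) => -[f1].
set M := Num.sqrt (\int[_]_x (cabs (g x) ^+ 2)) => max.
have M0 : 0 <= M by exact: sqrtr_ge0.
have M2 : M ^+ 2 = \int[circ_mu R]_x (cabs (g x) ^+ 2).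
  by rewrite sqr_sqrtr//; apply: Int_ge0 => t; rewrite sqr_ge0.
have {}f1 : \int[circ_mu R]_x (cabs (f x) ^+ 2) = 1.
  rewrite -[LHS]sqr_sqrtr ?f1 ?expr1n//.
  by apply: Int_ge0 => t; rewrite sqr_ge0.
have phiM : {ae circ_mu R, forall t, cabs (phi t) <= M}.
  have := ess_sup_ge (circ_mu R) (fun t => (cabs (phi t))%:E).
  by rewrite -max; apply: filterS => t; rewrite lee_fin.
(* [D] is the pointwise defect in |conj phi f| <= M |f|, nonnegative almost everywhere by maximality
   of the norm. *)
pose D t := M ^+ 2 * cabs (f t) ^+ 2 - cabs (conjc (phi t) * f t) ^+ 2.
have iM := intgZ (M ^+ 2) if2.
have iD : intg D by exact: intgB.
have DE t : D t = (M ^+ 2 - cabs (phi t) ^+ 2) * cabs (f t) ^+ 2.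
  by rewrite /D cabsM cabs_conjc exprMn mulrBl.
have D_ge0 : {ae circ_mu R, forall t, 0 <= D t}.
  apply: filterS phiM => t pt; rewrite DE mulr_ge0 ?sqr_ge0// subr_ge0.
  by rewrite ler_pXn2r ?nnegrE ?cabs_ge0.
(* The integral of [D] is M^2 minus the squared norm of conj phi f, hence at most 0 because the
   projection [g] has norm M. The absolute value makes the integrand nonnegative everywhere, as
   [Int_eq0_ae] requires. *)
have D0 : {ae circ_mu R, forall t, `|D t| = 0}.
  apply: (Int_eq0_ae (intg_norm iD)) => //.
  apply/eqP; rewrite eq_le Int_ge0 ?andbT//.
  rewrite (ae_eq_Int (intg_norm iD) iD); last first.
    by apply: filterS D_ge0 => t; exact: ger0_norm.
  rewrite (IntB iM ih) (IntZ _ if2) f1 mulr1 M2 subr_le0.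
  exact: Pbar_norm_le.
have fn0 : {ae circ_mu R, forall t, f t != 0}.
  by apply: inH2_neq0_ae => //; rewrite f1.
have phiE : {ae circ_mu R, forall t, cabs (phi t) ^+ 2 = M ^+ 2}.
  apply: filterS2 D0 fn0 => t /eqP; rewrite normr_eq0 DE mulf_eq0.
  rewrite sqrf_eq0 cabs_eq0 => /orP[|->//].
  by rewrite subr_eq0 => /eqP.
rewrite (ae_eq_Int iphi (intg_cst (M ^+ 2)) phiE) Int_cst sqrtr_sqr.
by rewrite ger0_norm.
Qed.
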